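(* Let $G_1$ be an $r_1$-regular graph on $n_1$ vertices and $m_1$ edges, and $G_2$ an arbitrary graph on $n_2$ vertices. Then $$\phi\left(A(G_1\dot{\vee} G_2);x\right)=\phi(A(G_2);x)\cdot x^{m_1-n_1}\cdot\Big(x^2-n_1 x\,\Gamma_{A(G_2)}(x)-2r_1\Big)\cdot\prod_{i=2}^{n_1}\Big(x^2-r_1-\lambda_i(G_1)\Big).$$
   Context: All graphs are finite, simple and undirected, with at least one vertex. For a graph $G$ on $n$ vertices, $A(G)$ is its adjacency matrix, with eigenvalues $\lambda_1(G)\ge\lambda_2(G)\ge\cdots\ge\lambda_n(G)$. For an $n\times n$ matrix $M$, $\phi(M;x)=\det(xI_n-M)$ is its characteristic polynomial, and the $M$-coronal is the rational function $\Gamma_M(x)=\mathbf{1}_n^T(xI_n-M)^{-1}\mathbf{1}_n$ (the sum of the entries of $(xI_n-M)^{-1}$), where $\mathbf{1}_n$ is the all-ones column vector. The subdivision graph $\mathcal{S}(G)$ is obtained from $G$ by inserting a new vertex into every edge of $G$. For vertex-disjoint graphs $G_1,G_2$, the subdivision-vertex join $G_1\dot{\vee}G_2$ is the graph obtained from $\mathcal{S}(G_1)$ and $G_2$ by joining every vertex of $V(G_1)$ (the original vertices) with every vertex of $V(G_2)$. The identity is understood as an identity of rational functions in $x$ (the exponent $m_1-n_1$ may be negative). *)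

(* Defs.v *)
From HB Require Import structures.
From mathcomp Require Import all_boot all_order all_algebra.
From mathcomp Require Import fraction polyrcf.

Set Implicit Arguments.
Unset Strict Implicit.
Unset Printing Implicit Defensive.

Import Order.TTheory GRing.Theory Num.Theory.
Local Open Scope ring_scope.

Record sgraph := SGraph {
  svertex :> finType;
  sedge : rel svertex;
  sedge_sym : symmetric sedge;
  sedge_irrefl : irreflexive sedge;
  svertex_gt0 : (0 < #|svertex|)%N
}.

Definition edges (G : sgraph) : {set {set G}} :=
  [set [set p.1; p.2] | p : G * G & sedge p.1 p.2].

Definition edge_of (G : sgraph) : finType := {e : {set G} | e \in edges G}.

Definition regular (G : sgraph) (r : nat) : Prop :=
  forall x : G, #|[set y | sedge x y]| = r.

Section Subdivision.
Variable G : sgraph.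

Definition subdiv_rel (u v : G + edge_of G) : bool :=
  match u, v with
  | inl x, inr e | inr e, inl x => x \in val e
  | _, _ => false
  end.

Fact subdiv_sym : symmetric subdiv_rel.
Proof. by move=> [x|e] [y|f]. Qed.

Fact subdiv_irrefl : irreflexive subdiv_rel.
Proof. by case. Qed.

Fact subdiv_gt0 : (0 < #|{: G + edge_of G}|)%N.
Proof. by rewrite card_sum addn_gt0 svertex_gt0. Qed.

Definition subdivision : sgraph :=
  SGraph subdiv_sym subdiv_irrefl subdiv_gt0.

End Subdivision.

Section SubdivisionVertexJoin.
Variables G1 G2 : sgraph.

Definition svjoin_rel (u v : subdivision G1 + G2) : bool :=
  match u, v with
  | inl a, inl b => sedge a b
  | inr y, inr z => sedge y z
  | inl (inl _), inr _ | inr _, inl (inl _) => true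
  | inl (inr _), inr _ | inr _, inl (inr _) => false
  end.

Fact svjoin_sym : symmetric svjoin_rel.
Proof.
by case=> [[x|e]|y] [[x'|e']|y'] //=; exact: sedge_sym.
Qed.

Fact svjoin_irrefl : irreflexive svjoin_rel.
Proof. by case=> [[x|e]|y] //=; exact: sedge_irrefl. Qed.

Fact svjoin_gt0 : (0 < #|{: subdivision G1 + G2}|)%N.
Proof. by rewrite card_sum addn_gt0 svertex_gt0. Qed.

Definition subdiv_vertex_join : sgraph :=
  SGraph svjoin_sym svjoin_irrefl svjoin_gt0.

End SubdivisionVertexJoin.

Definition adjmx (R : pzSemiRingType) (G : sgraph) : 'M[R]_#|G| :=
  \matrix_(i, j) (sedge (enum_val i) (enum_val j))%:R.

Notation "p %:F" := (@tofrac _ p) : ring_scope.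

(* [char_poly_mx M] is the polynomial matrix x I - M, here sent entrywise into
   the field of rational functions. *)
Definition coronal (F : fieldType) (n : nat) (M : 'M[F]_n) :
    {fraction {poly F}} :=
  let xI_M : 'M[{fraction {poly F}}]_n :=
    map_mx (@tofrac _) (char_poly_mx M) in
  ((const_mx 1 : 'rV_n) *m invmx xI_M *m (const_mx 1 : 'cV_n)) 0 0.

(* Real roots of the characteristic polynomial, repeated according to their
   multiplicity, in nonincreasing order; for a symmetric matrix of size n all n
   eigenvalues are real, so that this list has length n. *)
Definition spectrum (R : rcfType) (n : nat) (M : 'M[R]_n) : seq R :=
  let p := char_poly M in
  sort >=%R (flatten [seq nseq (mup a p) a | a <- rootsR p]).

(* One-based: [lambda R G 1] is the largest eigenvalue. *)
Definition lambda (R : rcfType) (G : sgraph) (i : nat) : R :=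
  (spectrum (adjmx R G))`_i.-1.

(* Main.v *)
(* Order the vertices as V(G1), E(G1), V(G2) and let B be the incidence matrix
   of G1. Eliminating the last two blocks of x I - A by a Schur complement and
   using B B^T = A(G1) + r1 I leaves, up to powers of x, the determinant of
   (x^2 - r1) I - A(G1) - x Gamma J with J the all-ones matrix. Since the
   all-ones vector is an eigenvector of A(G1) for r1, the rank-one term
   multiplies det ((x^2 - r1) I - A(G1)) = prod_i (x^2 - r1 - lambda_i) by
   (x^2 - 2 r1 - n1 x Gamma) / (x^2 - 2 r1), and the denominator is the factor
   i = 1 because lambda_1 = r1. *)

Require Import Defs.
From HB Require Import structures.
From mathcomp Require Import all_boot all_order all_algebra.
From mathcomp Require Import fraction polyrcf.
From mathcomp Require Import complex spectral perm ring.

Set Implicit Arguments.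
Unset Strict Implicit.
Unset Printing Implicit Defensive.

Import Order.TTheory GRing.Theory Num.Theory.
Local Open Scope ring_scope.

(** * Determinants: similarity, Schur complements and rank-one updates *)

Lemma char_poly_similar (F : idomainType) n (P A B : 'M[F]_n) :
  P \in unitmx -> P *m A = B *m P -> char_poly A = char_poly B.
Proof.
move=> Pu eqPA; pose Q := map_mx (@polyC F) P.
have Qu : Q \in unitmx.
  by rewrite !unitmxE in Pu *; rewrite det_map_mx rmorph_unit.
have eqQ : Q *m char_poly_mx A = char_poly_mx B *m Q.
  by rewrite mulmxBr mulmxBl -!map_mxM eqPA scalar_mxC.
move/(congr1 determinant): eqQ; rewrite !det_mulmx mulrC => /mulIr; apply.
by rewrite -unitmxE.
Qed.

(** Two enumerations of the same vertices differ by a permutation, so the matrices are conjugate by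
    a permutation matrix. This allows the join to be written in block order. *)
Lemma char_poly_reindex (R : idomainType) (T : finType) n (h : 'I_n -> T)
    (f : T -> T -> R) : bijective h ->
  char_poly (\matrix_(i < #|T|, j < #|T|) f (enum_val i) (enum_val j)) =
  char_poly (\matrix_(i < n, j < n) f (h i) (h j)).
Proof.
move=> bij_h; have En : #|T| = n by rewrite -(bij_eq_card bij_h) card_ord.
case: n / En in h bij_h *.
have inj_s : injective (enum_rank \o h).
  by apply: inj_comp; [exact: enum_rank_inj | exact: bij_inj].
pose s := perm inj_s.
apply: (@char_poly_similar _ _ (perm_mx s)); first exact: unitmx_perm.
rewrite -row_permE -[s in RHS]invgK -col_permE.
apply/matrixP => i j; rewrite !mxE permE /= enum_rankK.
suff -> : h ((s^-1)%g j) = enum_val j by [].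
by apply: enum_rank_inj; rewrite enum_valK -[RHS](permKV s) [in RHS]permE.
Qed.

(** Block column operations of determinant 1 clear the lower-left block. *)
Lemma det_schur_dr (R : comUnitRingType) m n (A : 'M[R]_m) (B : 'M_(m, n))
    (C : 'M_(n, m)) (D : 'M_n) : D \in unitmx ->
  \det (block_mx A B C D) = \det D * \det (A - B *m invmx D *m C).
Proof.
move=> Du; have := det_mulmx (block_mx A B C D)
  (block_mx 1%:M 0 (- (invmx D *m C)) 1%:M).
rewrite det_lblock !det1 !mulr1 => <-.
rewrite mulmx_block !(mulmx0, mulmx1, add0r) !mulmxN !mulmxA mulmxV //.
by rewrite mul1mx subrr det_ublock mulrC.
Qed.

Lemma det_schur_ul (R : comUnitRingType) m n (A : 'M[R]_m) (B : 'M_(m, n))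
    (C : 'M_(n, m)) (D : 'M_n) : A \in unitmx ->
  \det (block_mx A B C D) = \det A * \det (D - C *m invmx A *m B).
Proof.
move=> Au; have := det_mulmx (block_mx A B C D)
  (block_mx 1%:M (- (invmx A *m B)) 0 1%:M).
rewrite det_ublock !det1 !mulr1 => <-.
rewrite mulmx_block !(mulmx0, mulmx1, addr0) !mulmxN !mulmxA mulmxV //.
by rewrite mul1mx addNr det_lblock addrC.
Qed.

(** The two sides are the two Schur complements of one block matrix with identity diagonal
    blocks. *)
Lemma det_sub1_mul (R : comUnitRingType) m n (B : 'M[R]_(m, n))
    (C : 'M_(n, m)) : \det (1%:M - B *m C) = \det (1%:M - C *m B).
Proof.
have := det_schur_dr 1%:M B C (unitmx1 R n).
by rewrite det_schur_ul ?unitmx1 // !det1 !mul1r !invmx1 !mulmx1 => <-.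
Qed.

(** Since [M] scales the all-ones column by [d], the constant matrix factors as [M] times a rank-one
    matrix, which leaves a 1 by 1 determinant. No inverse of [M] is taken, so [M] may be
    singular. *)
Lemma det_sub_const (F : fieldType) n (M : 'M[F]_n) (c d : F) :
  d != 0 -> M *m const_mx 1 = d *: (const_mx 1 : 'cV_n) ->
  d * \det (M - const_mx c) = (d - c * n%:R) * \det M.
Proof.
move=> d0 Md.
have -> : M - const_mx c = M *m (1%:M - (const_mx 1 : 'cV_n) *m
    (const_mx (c / d) : 'rV_n)).
  rewrite mulmxBr mulmx1 mulmxA Md; congr (_ - _).
  by apply/matrixP=> i j; rewrite !(mxE, big_ord1) mulr1 mulrC divfK.
rewrite det_mulmx det_sub1_mul mulrCA mulrC; congr (_ * _).
rewrite det_mx11 !mxE eqxx.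
under eq_bigr do rewrite !mxE mulr1.
by rewrite sumr_const card_ord -[c / d *+ n]mulr_natr /=; field.
Qed.

(** * Real spectra of symmetric matrices *)

(* The spectral theorem is applied over R[i]. *)
Lemma sym_char_poly_splits (R : rcfType) n (A : 'M[R]_n) :
  A^T = A -> {s : seq R | char_poly A = \prod_(a <- s) ('X - a%:P)}.
Proof.
move=> symA; pose toC := real_complex R; pose AC := map_mx toC A.
have ACh : AC \is hermsymmx.
  apply: realsym_hermsym.
    apply/is_hermitianmxP; rewrite expr0 scale1r map_mx_id //.
    by rewrite /AC map_trmx symA.
  by apply/mxOverP => i j; rewrite mxE complex_real.
have /hermitian_normalmx/orthomx_spectralP ACE := ACh.
have spR := hermitian_spectral_diag_real ACh.
(* By [spR] the diagonal entries are real, so taking real parts loses nothing. *)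
exists [seq complex.Re (spectral_diag AC 0 i) | i <- enum 'I_n].
apply: (map_poly_inj toC); rewrite map_char_poly.
rewrite (@char_poly_similar _ _ (spectralmx AC) _ (diag_mx (spectral_diag AC))).
- rewrite char_poly_trig ?diag_mx_is_trig // big_map big_enum rmorph_prod /=.
  apply: eq_bigr => i _; rewrite !mxE eqxx rmorphB /= map_polyX map_polyC /=.
  by rewrite RRe_real //; apply/mxOverP.
- exact: spectral_unit.
- have := congr1 (mulmx (spectralmx AC)) ACE.
  by rewrite !mulmxA mulmxV ?spectral_unit // mul1mx.
Qed.

(** Each value occurs in either list as often as its multiplicity as a root of [char_poly A]. *)
Lemma spectrum_perm (R : rcfType) n (A : 'M[R]_n) (s : seq R) :
  char_poly A = \prod_(a <- s) ('X - a%:P) -> perm_eq (spectrum A) s.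
Proof.
move=> As; rewrite /spectrum perm_sort; apply/allP => x _ /=; apply/eqP.
have p0 := monic_neq0 (char_poly_monic A).
rewrite -[RHS]mu_prod_XsubC -As; set p := char_poly A in p0 *.
rewrite count_flatten -map_comp sumnE big_map.
have := roots_on_rootsR p0 => /(_ x); rewrite in_itv /= => rx.
have ur : uniq (rootsR p) by exact: uniq_roots.
under eq_bigr do rewrite /= count_nseq /=.
have [xr|xr] := boolP (x \in rootsR p).
  rewrite (bigD1_seq x) //= eqxx mul1n big1 ?addn0 // => i.
  by move/negPf ->.
rewrite mupNroot; last by rewrite rx.
by rewrite big_seq big1 // => i ir; case: eqP => // ix; rewrite -ix ir in xr.
Qed.

(** * Adjacency and incidence matrices of a regular graph *)

Lemma adjmx_sym (R : pzSemiRingType) (G : sgraph) : (adjmx R G)^T = adjmx R G.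
Proof. by apply/matrixP => i j; rewrite !mxE sedge_sym. Qed.

Lemma adjmx_row_sum (R : pzSemiRingType) (G : sgraph) r (i : 'I_#|G|) :
  regular G r -> \sum_j adjmx R G i j = r%:R.
Proof.
move=> regG; rewrite -(regG (enum_val i)) -sum1_card natr_sum.
rewrite [RHS](reindex_onto enum_val enum_rank) => [|x _]; last first.
  exact: enum_rankK.
under [LHS]eq_bigr do rewrite mxE.
rewrite [LHS](bigID (fun j => sedge (enum_val i) (enum_val j))) /=.
rewrite [X in _ + X]big1 ?addr0 => [|j /negPf -> //].
by apply: eq_big => [j|j ->//]; rewrite inE enum_valK eqxx andbT.
Qed.

Lemma adjmx_regular (R : pzSemiRingType) (G : sgraph) r :
  regular G r -> adjmx R G *m const_mx 1 = (const_mx r%:R : 'cV_#|G|).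
Proof.
move=> regG; apply/matrixP => i j; rewrite !mxE -(adjmx_row_sum _ i regG).
by apply: eq_bigr => k _; rewrite [const_mx _ _ _]mxE mulr1.
Qed.

Definition incmx (R : pzSemiRingType) (G : sgraph) :
    'M[R]_(#|G|, #|edge_of G|) :=
  \matrix_(i < #|G|, j < #|edge_of G|)
    (enum_val i \in val (enum_val j : edge_of G))%:R.

Lemma edgesP (G : sgraph) (e : {set G}) :
  reflect (exists x y, sedge x y /\ e = [set x; y]) (e \in edges G).
Proof.
apply: (iffP imsetP) => [[[x y]]|[x [y [xy ->]]]].
  by rewrite inE /= => xy ->; exists x, y.
by exists (x, y); rewrite ?inE.
Qed.

Lemma incident_edges (G : sgraph) (x : G) :
  [set e in edges G | x \in e] = [set [set x; y] | y in [set y | sedge x y]].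
Proof.
apply/setP => e; rewrite inE; apply/andP/imsetP => [[/edgesP[a [b [ab ->]]]]|].
  rewrite !inE => /orP[]/eqP->; [exists b; first by rewrite inE | exists a].
  - by [].
  - by rewrite inE sedge_sym.
  - exact: setUC.
case=> y; rewrite inE => xy ->; rewrite !inE eqxx; split=> //.
by apply/edgesP; exists x, y.
Qed.

Lemma pair_set_inj (G : sgraph) (x : G) :
  {in [set y | sedge x y] &, injective (fun y => [set x; y])}.
Proof.
move=> y z; rewrite !inE => xy xz /setP/(_ y).
rewrite !inE eqxx orbT => /esym/orP[]/eqP // yx.
by rewrite yx sedge_irrefl in xy.
Qed.

(** The edges through [x] are the pairs [[set x; z]] with [z] a neighbour of [x]. If [x = y] all of
    them count, which gives the degree; otherwise [y] must be [z], which leaves at most one edge. *)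
Lemma card_common_edges (G : sgraph) r (x y : G) : regular G r ->
  #|[set e in edges G | (x \in e) && (y \in e)]| =
  (sedge x y + (x == y) * r)%N.
Proof.
move=> regG.
have -> : [set e in edges G | (x \in e) && (y \in e)] =
    [set [set x; z] | z in [set z | sedge x z & y \in [set x; z]]].
  apply/setP => e; rewrite inE andbA.
  have := incident_edges x => /setP/(_ e); rewrite inE => ->.
  apply/andP/imsetP => [[/imsetP[z]]|[z]]; rewrite inE.
    by move=> xz -> yz; exists z; rewrite // inE xz.
  by case/andP=> xz yz ->; split=> //; apply: imset_f; rewrite inE.
rewrite card_in_imset; last first.
  move=> u v; rewrite !inE => /andP[xu _] /andP[xv _].
  by apply: pair_set_inj; rewrite inE.
have [<-|xy] := eqVneq x y.
  rewrite sedge_irrefl mul1n -(regG x); apply: eq_card => z.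
  by rewrite !inE eqxx andbT.
rewrite mul0n addn0.
have -> : [set z | sedge x z & y \in [set x; z]] =
    [set z in [set y] | sedge x z].
  apply/setP => z; rewrite !inE andbC eq_sym (negPf xy) /=.
  by rewrite [y == z]eq_sym.
case xye: (sedge x y).
  rewrite /= -(cards1 y); apply: eq_card => z; rewrite !inE.
  by case: eqP => // ->.
by apply: eq_card0 => z; rewrite !inE; case: eqP => // ->.
Qed.

Lemma incmx_mul_tr (R : pzSemiRingType) (G : sgraph) r : regular G r ->
  incmx R G *m (incmx R G)^T = adjmx R G + r%:R%:M.
Proof.
move=> regG; apply/matrixP => i j; rewrite !mxE.
rewrite -mulrnA mulnC -[i == j](inj_eq enum_val_inj) -natrD.
rewrite -(card_common_edges _ _ regG).
under eq_bigr do rewrite !mxE -natrM mulnb.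
rewrite -natr_sum; congr _%:R.
pose F (e : {set G}) : nat := (enum_val i \in e) && (enum_val j \in e).
(* The sum moves from ordinals to the type of edges, and then to vertex sets belonging to
   [edges G]. *)
transitivity (\sum_(e : edge_of G) F (val e))%N.
  by rewrite -(big_enum_val (fun e : edge_of G => F (val e))).
rewrite -(big_sub (mem (edges G)) F) -sum1_card big_mkcond [RHS]big_mkcond.
by apply: eq_bigr => e _; rewrite inE /F; do 3!case: (_ \in _).
Qed.

(** * The largest eigenvalue of a regular graph *)

Lemma regular_eigenvalue_le (R : realFieldType) (G : sgraph) r (a : R) :
  regular G r -> root (char_poly (adjmx R G)) a -> a <= r%:R.
Proof.
move=> regG; rewrite -eigenvalue_root_char => /eigenvalueP[v vA v0].
have [i0 vi0] : exists i, v 0 i != 0.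
  apply/existsP; apply: contraNT v0 => /existsPn v0; apply/eqP/rowP => i.
  by apply/eqP; rewrite mxE; have := v0 i; rewrite negbK.
(* Compare both sides of v A = a v at an entry of largest absolute value. *)
pose i := [arg max_(k > i0) `|v 0 k|]%O.
have vmax k : `|v 0 k| <= `|v 0 i|.
  by rewrite /i; case: arg_maxP => // k' _; apply.
have vi : 0 < `|v 0 i| by apply: lt_le_trans (vmax i0); rewrite normr_gt0.
rewrite -(ler_pM2r vi); apply: le_trans (ler_wpM2r (ltW vi) (ler_norm a)) _.
rewrite -normrM; have /rowP/(_ i) := vA; rewrite !mxE => <-.
apply: le_trans (ler_norm_sum _ _ _) _.
rewrite -(adjmx_row_sum _ i regG) mulr_suml; apply: ler_sum => k _.
(* The product [v *m A] runs along column [i]; symmetry turns it into row [i], whose sum is [r]. *)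
rewrite normrM mulrC -[in X in X * _](adjmx_sym R G) [in X in X * _]mxE.
rewrite ger0_norm ?ler_wpM2l // mxE ?ler0n //.
Qed.

(** The all-ones vector shows that [r] occurs in the spectrum, and every eigenvalue is at most [r];
    the head of the nonincreasing list is therefore [r]. *)
Lemma lambda1_regular (R : rcfType) (G : sgraph) r :
  regular G r -> lambda R G 1 = r%:R.
Proof.
move=> regG; have [s sE] := sym_char_poly_splits (adjmx_sym R G).
have ps := spectrum_perm sE.
have le_r a : a \in spectrum (adjmx R G) -> a <= r%:R.
  rewrite (perm_mem ps) => ars; apply: (regular_eigenvalue_le regG).
  by rewrite sE root_prod_XsubC.
have r_in : r%:R \in spectrum (adjmx R G).
  rewrite (perm_mem ps) -root_prod_XsubC -sE -eigenvalue_root_char.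
  apply/eigenvalueP; exists (const_mx 1).
    rewrite -[LHS]trmxK trmx_mul adjmx_sym trmx_const (adjmx_regular _ regG) //.
    by apply/matrixP=> i j; rewrite !mxE mulr1.
  apply/eqP => /rowP/(_ (Ordinal (svertex_gt0 G))); rewrite !mxE => /eqP.
  by rewrite oner_eq0.
have : sorted >=%R (spectrum (adjmx R G)) by apply/sort_sorted/ge_total.
(* Membership of [r] rules out the empty list, where [lambda] would be the default 0. *)
rewrite /lambda; case: (spectrum _) r_in le_r => [//|a t] r_in le_r /=.
move/(order_path_min ge_trans)/allP => at_max; apply/le_anti/andP; split.
  by apply: le_r; rewrite mem_head.
by move: r_in; rewrite inE => /orP[/eqP->//|/at_max].
Qed.

(** * The adjacency matrix of the join in the block order V(G1), E(G1), V(G2) *)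

Section JoinIndex.
Variables G1 G2 : sgraph.
Let n := (#|G1| + (#|edge_of G1| + #|G2|))%N.

Definition join_vertex (i : 'I_n) : subdiv_vertex_join G1 G2 :=
  match split i with
  | inl j => inl (inl (enum_val j))
  | inr k => match split k with
             | inl e => inl (inr (enum_val e))
             | inr y => inr (enum_val y)
             end
  end.

Definition join_rank (u : subdiv_vertex_join G1 G2) : 'I_n :=
  match u with
  | inl (inl x) => lshift _ (enum_rank x)
  | inl (inr e) => rshift _ (lshift _ (enum_rank e))
  | inr y => rshift _ (rshift _ (enum_rank y))
  end.

Lemma join_vertex_bij : bijective join_vertex.
Proof.
exists join_rank => [i|[[x|e]|y]]; rewrite /join_vertex /=; last first.
- by rewrite !(unsplitK (inr _)) enum_rankK.
- by rewrite (unsplitK (inr _)) (unsplitK (inl _)) enum_rankK.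
- by rewrite (unsplitK (inl _)) enum_rankK.
case: split_ordP => [j ->|k ->] /=; first by rewrite enum_valK.
by case: split_ordP => [j ->|j ->] /=; rewrite enum_valK.
Qed.

Lemma adjmx_join (R : nzRingType) :
  \matrix_(i, j) (sedge (join_vertex i) (join_vertex j))%:R =
  block_mx 0 (row_mx (incmx R G1) (const_mx 1))
    (col_mx (incmx R G1)^T (const_mx 1)) (block_mx 0 0 0 (adjmx R G2)).
Proof.
apply/matrixP => i j; rewrite mxE /join_vertex.
case: (split_ordP i) => [a ->|k ->]; case: (split_ordP j) => [b ->|l ->].
- by rewrite block_mxEul mxE.
- rewrite block_mxEur; case: (split_ordP l) => [b ->|b ->].
    by rewrite row_mxEl mxE.
  by rewrite row_mxEr mxE.
- rewrite block_mxEdl; case: (split_ordP k) => [a ->|a ->].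
    by rewrite col_mxEu !mxE.
  by rewrite col_mxEd mxE.
rewrite block_mxEdr.
case: (split_ordP k) => [a ->|a ->]; case: (split_ordP l) => [b ->|b ->].
- by rewrite block_mxEul mxE.
- by rewrite block_mxEur mxE.
- by rewrite block_mxEdl mxE.
- by rewrite block_mxEdr mxE.
Qed.

End JoinIndex.

Lemma map_incmx (R S : nzRingType) (f : {rmorphism R -> S}) (G : sgraph) :
  map_mx f (incmx R G) = incmx S G.
Proof. by apply/matrixP => i j; rewrite !mxE rmorph_nat. Qed.

Lemma map_adjmx (R S : nzRingType) (f : {rmorphism R -> S}) (G : sgraph) :
  map_mx f (adjmx R G) = adjmx S G.
Proof. by apply/matrixP => i j; rewrite !mxE rmorph_nat. Qed.

Lemma frac_char_poly_mx (R : fieldType) n (A : 'M[R]_n) :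
  map_mx (@tofrac {poly R}) (char_poly_mx A) =
  ('X%:F)%:M - map_mx (@tofrac _ \o polyC) A.
Proof. by rewrite map_mxB map_scalar_mx map_mx_comp. Qed.

Lemma char_poly_join (R : fieldType) (G1 G2 : sgraph) :
  let x : {fraction {poly R}} := 'X%:F in
  let B := incmx {fraction {poly R}} G1 in
  let M := map_mx (@tofrac _) (char_poly_mx (adjmx R G2)) in
  (char_poly (adjmx R (subdiv_vertex_join G1 G2)))%:F =
  \det (block_mx x%:M (row_mx (- B) (- const_mx 1))
         (col_mx (- B^T) (- const_mx 1)) (block_mx x%:M 0 0 M)).
Proof.
move=> x B M.
have -> := char_poly_reindex (fun u v => (sedge u v)%:R : R)
  (@join_vertex_bij G1 G2).
rewrite adjmx_join.
rewrite -det_map_mx frac_char_poly_mx /M frac_char_poly_mx.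
rewrite !(map_block_mx, map_row_mx, map_col_mx) -map_trmx map_incmx map_adjmx.
rewrite !map_mx0 !map_const_mx rmorph1 !scalar_mx_block !opp_block_mx.
rewrite opp_row_mx opp_col_mx !add_block_mx !add0r.
by rewrite !subr0 !oppr0.
Qed.

(** * Evaluation of the block determinant over rational functions *)

Lemma char_poly_horner (R : fieldType) n (A : 'M[R]_n) (y : R) :
  (char_poly A).[y] = \det (y%:M - A).
Proof.
rewrite -horner_evalE -det_map_mx; congr determinant.
by apply/matrixP => i j; rewrite !mxE /= horner_evalE !(hornerE, hornerMn).
Qed.

(** The factorization over [R] is carried to the fraction field and evaluated at [y]; it is needed
    at [x ^+ 2 - r], which is why [y] is an arbitrary rational function. *)
Lemma det_scalar_sub_adjmx (R : rcfType) (G : sgraph)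
    (y : {fraction {poly R}}) :
  \det (y%:M - adjmx _ G) =
  \prod_(1 <= i < #|G|.+1) (y - (lambda R G i)%:P%:F).
Proof.
have [s sE] := sym_char_poly_splits (adjmx_sym R G).
have ps := spectrum_perm sE.
have sz : size (spectrum (adjmx R G)) = #|G|.
  have := size_char_poly (adjmx R G).
  by rewrite sE size_prod_XsubC -(perm_size ps) => -[].
rewrite -char_poly_horner -(map_adjmx (@tofrac {poly R} \o polyC)).
rewrite -map_char_poly sE.
(* [big_add1] reconciles the one-based [lambda] with the zero-based [nth]. *)
rewrite -(perm_big _ ps) rmorph_prod horner_prod (big_nth 0) sz big_add1 /=.
apply: eq_bigr => i _.
by rewrite rmorphB /= map_polyX map_polyC /= !hornerE.
Qed.

(** The factor [x ^+ 2 - 2 * r] on the left is the eigenvalue of the all-ones vector that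
    [det_sub_const] requires; keeping it there avoids a quotient. *)
Lemma det_join_block (F : fieldType) n m p (A : 'M[F]_n) (B : 'M_(n, m))
    (M : 'M_p) (x r : F) :
    x != 0 -> x ^+ 2 - 2 * r != 0 -> M \in unitmx ->
    B *m B^T = A + r%:M -> A *m const_mx 1 = (const_mx r : 'cV_n) ->
  let c := ((const_mx 1 : 'rV_p) *m invmx M *m (const_mx 1 : 'cV_p)) 0 0 in
  (x ^+ 2 - 2 * r) *
  \det (block_mx x%:M (row_mx (- B) (- const_mx 1))
         (col_mx (- B^T) (- const_mx 1)) (block_mx x%:M 0 0 M)) =
  \det M * x ^ (m%:Z - n%:Z) * (x ^+ 2 - n%:R * x * c - 2 * r)
  * \det ((x ^+ 2 - r)%:M - A).
Proof.
move=> x0 xr0 Mu BBt A1 c.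
have Xu k : (x%:M : 'M_k) \in unitmx.
  by rewrite unitmxE det_scalar unitrX // unitfE.
have Du : block_mx (x%:M : 'M_m) 0 0 M \in unitmx.
  by rewrite block_diag_mx_unit Xu.
rewrite det_schur_dr // det_ublock det_scalar.
rewrite invmx_block_diag // invmx_scalar mul_row_block !mulmx0 addr0 add0r.
rewrite mul_row_col !mulNmx !mulmxN !opprK mul_mx_scalar -scalemxAl BBt.
have -> : const_mx 1 *m invmx M *m const_mx 1 = const_mx c :> 'M_n.
  apply/matrixP => i j; rewrite /c !mxE; apply: eq_bigr => k _.
  by rewrite !mxE; congr (_ * _); apply: eq_bigr => l _; rewrite !mxE.
(* Extracting [x^-1] from this matrix of size [n] contributes [x ^- n]; the edge block has already
   contributed [x ^+ m]. *)
have -> : x%:M - (x^-1 *: (A + r%:M) + const_mx c) =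
    x^-1 *: (((x ^+ 2 - r)%:M - A) - const_mx (x * c)).
  apply/matrixP => i j; rewrite !mxE.
  by case: (i == j); rewrite ?mulr1n ?mulr0n; field.
have S1 : ((x ^+ 2 - r)%:M - A) *m const_mx 1 =
    (x ^+ 2 - 2 * r) *: (const_mx 1 : 'cV_n).
  rewrite mulmxBl A1 mul_scalar_mx; apply/matrixP => i j; rewrite !mxE; ring.
rewrite detZ; have := det_sub_const (x * c) xr0 S1.
set D := \det (_ - const_mx _) => DE.
transitivity (x ^+ m * x^-1 ^+ n * \det M * ((x ^+ 2 - 2 * r) * D)).
  by ring.
rewrite DE expfzDr // -exprnP -exprnN -exprVn; ring.
Qed.

Theorem theorem2p4 (R : rcfType) (G1 G2 : sgraph) (n1 m1 r1 : nat)
    (hn1 : #|G1| = n1) (hm1 : #|edges G1| = m1) (hr1 : regular G1 r1) :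
  let x : {fraction {poly R}} := 'X%:F in
  (char_poly (adjmx R (subdiv_vertex_join G1 G2)))%:F =
    (char_poly (adjmx R G2))%:F
    * x ^ (m1%:Z - n1%:Z)
    * (x ^+ 2 - n1%:R * x * coronal (adjmx R G2) - 2 * r1%:R)
    * \prod_(2 <= i < n1.+1) (x ^+ 2 - r1%:R - (lambda R G1 i)%:P%:F).
Proof.
move=> x; subst n1 m1; rewrite char_poly_join -/x.
set M := map_mx _ _.
have x0 : x != 0 by rewrite tofrac_eq0 polyX_eq0.
have xr0 : x ^+ 2 - 2 * r1%:R != 0.
  (* It is the image of a monic polynomial, hence nonzero. *)
  have -> : x ^+ 2 - 2 * r1%:R = ('X^2 - (2 * r1%:R)%:P)%:F.
    by rewrite tofracB tofracXn -!natrM polyC_natr tofracMn tofrac1.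
  by rewrite tofrac_eq0 monic_neq0 // monicXnsubC.
have MD : \det M = (char_poly (adjmx R G2))%:F by rewrite det_map_mx.
have Mu : M \in unitmx.
  by rewrite unitmxE MD unitfE tofrac_eq0 monic_neq0 ?char_poly_monic.
(* Both sides are multiplied by the factor [i = 1] of the full eigenvalue product, so that the
   product from 2 can be completed. *)
apply: (mulfI xr0).
rewrite (det_join_block x0 xr0 Mu (incmx_mul_tr _ hr1) (adjmx_regular _ hr1)).
rewrite det_scalar_sub_adjmx big_ltn ?ltnS ?svertex_gt0 //.
rewrite (lambda1_regular _ hr1) polyC_natr tofracMn tofrac1 MD.
have -> : #|edge_of G1| = #|edges G1| by rewrite card_sig; apply: eq_card.
rewrite -/(coronal _).
set g := coronal _; set P := \prod_(_ <= _ < _) _; set z := x ^ _.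
have -> : x ^+ 2 - r1%:R - r1%:R = x ^+ 2 - 2 * r1%:R by ring.
by rewrite mulrA [LHS]mulrAC mulrC mulrA.
Qed.
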